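(* For $d=3$ and $k=2$ we have $S(3,2)=4$, and any solvable puzzle in $puz[3,2,4]$ can be solved in at most $10$ moves, i.e. any two configurations lying in the same connected component of $puz[3,2,4]$ are at graph distance at most $10$. Furthermore, the strong parity property holds for $puz[3,2,S(3,2)]$.
   Context: Let $d\ge 1$, $1\le k\le d$, $1\le l\le 2^d$ be integers. $Q^d$ is the graph of vertices and edges of the $d$-dimensional cube, with vertex set $\{0,1\}^d$. A $k$-dimensional face ($k$-face) of $Q^d$ is a set of $2^k$ vertices obtained by fixing $d-k$ of the coordinates. $\mathcal{C}[d,l]$ is the set of all configurations of $2^d-l$ tokens, labeled $1,\dots,2^d-l$, placed on distinct vertices of $Q^d$ (so $l$ vertices are unoccupied). For a configuration $C$, $\mathcal L_C=\{1,\dots,2^d-l\}$ is its set of labels (tokens). Moves: if a token $t$ sits at a vertex of a $k$-face $\sigma$ and all remaining vertices of $\sigma$ are unoccupied, then $t$ can be moved to any other vertex of $\sigma$; this is called a $k$-move. The puzzle graph $puz[d,k,l]$ has vertex set $\mathcal{C}[d,l]$, with $C$ and $D$ joined by an edge when one is reached from the other by a single $k$-move. A puzzle is a pair consisting of an initial and a target configuration; it is solvable if both lie in the same connected component. A configuration $C$ is $k$-isolated if no token can perform a $k$-move; it is $k$-semi-isolated if there is a non-empty proper subset $\mathcal A_C\subsetneq\mathcal L_C$ such that every configuration in the connected component of $C$ in $puz[d,k,l]$ is obtained from $C$ by a series of $k$-moves affecting only tokens in $\mathcal L_C\setminus\mathcal A_C$; it is $k$-mobile if it is neither $k$-isolated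 nor $k$-semi-isolated. $puz[d,k,l]$ has the strong parity property if it has exactly two connected components containing $k$-mobile configurations. A configuration is obtained from $C$ by a permutation $g$ if it has the same occupied vertices and the labels are permuted by $g$. $puz[d,k,l]$ has the even solvability property if there is a configuration $C\in\mathcal C[d,l]$ such that all configurations obtained from $C$ by an even permutation of the labels lie in the same connected component of $puz[d,k,l]$ as $C$. $S(d,k)$ is the minimum integer $l$ such that $puz[d,k,l]$ has the even solvability property. *)

(* Defs.v *)
From mathcomp Require Import all_boot all_fingroup.

Set Implicit Arguments.
Unset Strict Implicit.
Unset Printing Implicit Defensive.

Definition vertex (d : nat) := {ffun 'I_d -> bool}.

Definition is_kface (d k : nat) (sigma : {set vertex d}) : bool :=
  [exists F : {set 'I_d}, exists a : vertex d,
     (#|F| == d - k) &&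
     (sigma == [set v : vertex d | [forall i in F, v i == a i]])].

(* The labels 1, ..., 2^d - l are represented by 'I_(2 ^ d - l). *)
Definition label (d l : nat) := 'I_(2 ^ d - l).

Definition config (d l : nat) :=
  {f : {ffun label d l -> vertex d} | injectiveb f}.

Definition pos (d l : nat) (C : config d l) (t : label d l) : vertex d :=
  val C t.

Definition unoccupied (d l : nat) (C : config d l) (v : vertex d) : bool :=
  [forall t, pos C t != v].

(* D is reached from C by a single k-move of the token t. *)
Definition kmove_of (d k l : nat) (t : label d l) : rel (config d l) :=
  fun C D =>
    [exists sigma : {set vertex d},
      [&& is_kface k sigma,
          pos C t \in sigma,
          [forall v in sigma :\ pos C t, unoccupied C v],
          pos D t \in sigma :\ pos C t
        & [forall s, (s != t) ==> (pos D s == pos C s)]]].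

Definition kmove_in (d k l : nat) (B : {set label d l}) : rel (config d l) :=
  fun C D => [exists t in B, kmove_of k t C D].

(* Adjacency in the puzzle graph puz[d,k,l]; it is symmetric, by puz_sym. *)
Definition puz (d k l : nat) : rel (config d l) :=
  fun C D => [exists t, kmove_of k t C D].

Arguments puz : clear implicits.

Lemma puz_sym d k l : symmetric (puz d k l).
Proof.
suff H C D : puz d k l C D -> puz d k l D C by move=> C D; apply/idP/idP; apply: H.
case/existsP=> t /existsP[sg /and5P[face Ct_sg /forallP free Dt /forallP same]].
move: Dt; rewrite !inE => /andP[nDC Dt_sg].
apply/existsP; exists t; apply/existsP; exists sg.
rewrite face Dt_sg !inE Ct_sg (eq_sym (pos C t)) nDC /=.
apply/andP; split; apply/forallP => x; last first.
  by apply/implyP => nxt; rewrite eq_sym; exact: (implyP (same x)).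
apply/implyP; rewrite !inE => /andP[nxD x_sg].
apply/forallP => s; case: (eqVneq s t) => [->|nst]; first by rewrite eq_sym.
rewrite (eqP (implyP (same s) nst)).
case: (eqVneq x (pos C t)) => [->|nxC].
  apply: contraNneq nst => e; apply/eqP.
  by apply: (injectiveP _ (valP C)); exact: e.
by have /implyP := free x; rewrite !inE nxC x_sg => /(_ isT) /forallP/(_ s).
Qed.

Definition component (d k l : nat) (C : config d l) : {set config d l} :=
  [set D | connect (puz d k l) C D].

Definition solvable_puzzle (d k l : nat) (C D : config d l) : bool :=
  connect (puz d k l) C D.

Definition solvable_within (d k l m : nat) (C D : config d l) : Prop :=
  exists p : seq (config d l),
    [/\ path (puz d k l) C p, last C p = D & size p <= m].

Definition isolated (d k l : nat) (C : config d l) : bool :=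
  [forall D, ~~ puz d k l C D].

Definition semi_isolated (d k l : nat) (C : config d l) : bool :=
  [exists A : {set label d l},
    [&& A != set0, A \proper [set: label d l]
      & [forall D in component k C, connect (kmove_in k (~: A)) C D]]].

Definition mobile (d k l : nat) (C : config d l) : bool :=
  ~~ isolated k C && ~~ semi_isolated k C.

Definition strong_parity (d k l : nat) : Prop :=
  #|[set component k C | C : config d l & mobile k C]| = 2.

Definition permuted (d l : nat) (g : {perm label d l}) (C D : config d l)
  : bool :=
  [forall t, pos D t == pos C (g t)].

Definition even_solvability (d k l : nat) : bool :=
  [exists C : config d l, [forall g : {perm label d l}, ~~ odd_perm g ==>
     [forall D, permuted g C D ==> (D \in component k C)]]].

Lemma even_solvability_ex d k :
  exists l, [&& 1 <= l, l <= 2 ^ d & even_solvability d k l].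
Proof.
exists (2 ^ d); rewrite expn_gt0 leqnn /=.
have no (t : label d (2 ^ d)) : False by case: t => m; rewrite subnn.
have inj : injectiveb (finfun (fun t => False_rect (vertex d) (no t))).
  by apply/injectiveP => t; case: (no t).
pose C : config d (2 ^ d) :=
  exist (fun f : {ffun label d (2 ^ d) -> vertex d} => is_true (injectiveb f))
    _ inj.
apply/existsP; exists C; apply/forallP => g; apply/implyP => _.
apply/forallP => D; apply/implyP => _; rewrite inE.
suff -> : D = C by exact: connect0.
by apply: val_inj; apply/ffunP => t; case: (no t).
Qed.

(* The minimum is over 1 <= l <= 2^d, the range on which puz[d,k,l] is defined. *)
Definition S_min (d k : nat) : nat := ex_minn (even_solvability_ex d k).

(* Main.v *)
Require Import Defs.
From mathcomp Require Import all_boot all_fingroup.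

(** A token can move only along a face all of whose other vertices are empty,
    hence only if some coordinate separates it from all other tokens.  With at
    least 5 tokens two different tokens cannot both be separated in this way, and
    a move preserves the separating coordinate; so in each component at most one
    token ever moves, and even solvability fails for [l < 4].

    For [l = 4] the 1680 configurations are encoded as quadruples of bit triples,
    and a breadth-first search from two configurations finds two sets of states
    closed under moves, which contain all non-isolated configurations and are
    exchanged by every transposition of labels.  So permuting the labels preserves
    the component of a non-isolated configuration exactly when the permutation is
    even.  Searches of depth 10 from three configurations exhaust their components,
    and these three represent all non-isolated ones up to relabelling the tokens
    and symmetries of the cube. *)

Set Implicit Arguments.
Unset Strict Implicit.
Unset Printing Implicit Defensive.

(** * Breadth-first search *)

Section Walk.
Variable T : eqType.
Implicit Types (f : T -> seq T) (x y : T).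

Definition walk f n x y :=
  exists p, [/\ path (fun a b => b \in f a) x p, last x p = y & size p <= n].

Lemma walk0 f n x : walk f n x x.
Proof. by exists [::]. Qed.

Lemma walk_rcons f n x y z : walk f n x y -> z \in f y -> walk f n.+1 x z.
Proof.
case=> p [px <- sp] zy; exists (rcons p z).
by rewrite rcons_path px last_rcons size_rcons.
Qed.

Lemma walk_closed f (P : pred T) n x y :
  (forall a b, P a -> b \in f a -> P b) -> walk f n x y -> P x -> P y.
Proof.
move=> cl [p [+ + _]]; elim: p x => [|a p IH] x /=; first by move=> _ ->.
by case/andP=> ax pa la Px; apply: (IH a) => //; apply: cl Px ax.
Qed.

(** The map [s] is only known to respect steps on [P]; since [P] is closed under steps, the whole
    walk stays where [s] can be applied. *)
Lemma walk_map f (P : pred T) (s : T -> T) n x y :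
    (forall a b, P a -> b \in f a -> P b) ->
    (forall a b, P a -> b \in f a -> s b \in f (s a)) ->
  P x -> walk f n x y -> walk f n (s x) (s y).
Proof.
move=> cl mor Px [p [px <- sp]]; exists (map s p).
rewrite last_map size_map; split=> //.
elim: p x Px px {sp} => //= a p IH x Px /andP[ax pa].
by rewrite mor //= IH //; apply: cl Px ax.
Qed.

End Walk.

(** A set of bit strings as a binary tree: the flag of a node tells whether the string read so far
    belongs to the set, and the first subtree continues with [true]. Lookup and insertion take time
    linear in the key. *)
Inductive trie := Leaf | Node of bool & trie & trie.

Definition trie_root t := if t is Node b _ _ then b else false.
Definition trie_sub (c : bool) t :=
  if t is Node _ l r then if c then l else r else Leaf.

Fixpoint trie_mem (t : trie) (k : seq bool) : bool :=
  if k is c :: k' then trie_mem (trie_sub c t) k' else trie_root t.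

Fixpoint trie_add (k : seq bool) (t : trie) : trie :=
  if k is c :: k' then
    if c then Node (trie_root t) (trie_add k' (trie_sub true t)) (trie_sub false t)
    else Node (trie_root t) (trie_sub true t) (trie_add k' (trie_sub false t))
  else Node true (trie_sub true t) (trie_sub false t).

Lemma trie_mem_Leaf k : trie_mem Leaf k = false.
Proof. by elim: k. Qed.

Lemma trie_mem_add k t k' :
  trie_mem (trie_add k t) k' = (k' == k) || trie_mem t k'.
Proof. by elim: k t k' => [|[] k IH] t [|[] k'] //=; rewrite IH. Qed.

Section Search.
Variables (T : eqType) (key : T -> seq bool).
Hypothesis key_inj : injective key.
Implicit Types (f : T -> seq T) (x y : T) (t : trie).

Definition inside t x : bool := trie_mem t (key x).

(** The pair holds the next frontier and all points seen so far. *)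
Definition visit (fv : seq T * trie) (y : T) : seq T * trie :=
  if inside fv.2 y then fv else (y :: fv.1, trie_add (key y) fv.2).

Fixpoint bfs f n (fr : seq T) t :=
  if n is n'.+1 then
    let fv := foldl visit ([::], t) (flatten (map f fr)) in
    bfs f n' fv.1 fv.2
  else t.

Definition ball f n x := bfs f n [:: x] (trie_add (key x) Leaf).

Lemma inside_add x t y : inside (trie_add (key x) t) y = (y == x) || inside t y.
Proof. by rewrite /inside trie_mem_add (inj_eq key_inj). Qed.

(** Soundness of the search; that the computed balls are closed under moves is checked by evaluation
    in [in_closed]. *)
Lemma ball_walk f n x y : inside (ball f n x) y -> walk f n x y.
Proof.
(* Invariant: after [m] rounds both the frontier and the visited points are within [m] steps of
   [x]. *)
have: forall m fr t, (forall z, z \in fr -> walk f m x z) ->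
    (forall z, inside t z -> walk f m x z) ->
    inside (bfs f n fr t) y -> walk f (m + n) x y.
  elim: n => [|n IH] m fr t /= Hfr Ht; first by rewrite addn0; exact: Ht.
  rewrite addnS -addSn; set fv := foldl _ _ _.
  suff H z : (z \in fv.1) || inside fv.2 z -> walk f m.+1 x z.
    by apply: IH => z zP; apply: H; rewrite zP ?orbT.
  have {}Hfr w : w \in flatten (map f fr) -> walk f m.+1 x w.
    by case/flatten_mapP=> v /Hfr wf; exact: walk_rcons.
  pose uv : seq T * trie := ([::], t).
  have {}Ht w : (w \in uv.1) || inside uv.2 w -> walk f m.+1 x w.
    by move=> /Ht [p [px lp sp]]; exists p; split=> //; exact: leqW.
  rewrite /fv -/uv; move: (flatten _) (uv) Hfr Ht.
  elim=> [|v s IHs] /= {}uv Hs Huv; first exact: Huv.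
  apply: IHs => [w ws|w]; first by apply: Hs; rewrite inE ws orbT.
  rewrite /visit; case: ifP => _ /=; first exact: Huv.
  rewrite inE inside_add orbACA orbb => /orP[/eqP->|/Huv//].
  by apply: Hs; rewrite mem_head.
rewrite -[n]add0n; apply=> z; first by rewrite inE => /eqP->; exact: walk0.
rewrite inside_add /inside trie_mem_Leaf orbF => /eqP->; exact: walk0.
Qed.

End Search.

(** * Encoding of the configurations *)

Definition cube := (bool * bool * bool)%type.
Definition state := (cube * cube * cube * cube)%type.

Definition coord (v : cube) (i : nat) : bool :=
  let: (a, b, c) := v in nth a [:: a; b; c] i.
Definition mkcube (f : nat -> bool) : cube := (f 0, f 1, f 2).

Definition get (x : state) (t : nat) : cube :=
  let: (a, b, c, d) := x in nth a [:: a; b; c; d] t.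
Definition mkstate (f : nat -> cube) : state := (f 0, f 1, f 2, f 3).

Lemma coord_mk f i : i < 3 -> coord (mkcube f) i = f i.
Proof. by case: i => [|[|[|]]]. Qed.

Lemma get_mk f t : t < 4 -> get (mkstate f) t = f t.
Proof. by case: t => [|[|[|[|]]]]. Qed.

Lemma get_inj x y : (forall t, t < 4 -> get x t = get y t) -> x = y.
Proof.
case: x y => [[[x0 x1] x2] x3] [[[y0 y1] y2] y3] e.
by have /= -> := e 0 isT; have /= -> := e 1 isT; have /= -> := e 2 isT;
  have /= -> := e 3 isT.
Qed.

Definition cubes : seq cube :=
  [seq (p, c) | p <- [seq (a, b) | a <- [:: false; true], b <- [:: false; true]],
    c <- [:: false; true]].

Lemma mem_cubes v : v \in cubes.
Proof. by case: v => [[[] []] []]. Qed.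

(* The conditional, unlike [==>], is not strict under call-by-value evaluation. *)
Definition all_states (D P : pred state) : bool :=
  all (fun a => all (fun b => all (fun c => all (fun d =>
    if D (a, b, c, d) then P (a, b, c, d) else true) cubes) cubes) cubes) cubes.

Lemma all_statesP (D P : pred state) : all_states D P -> forall x, D x -> P x.
Proof.
move=> + [[[a b] c] d] => /allP/(_ a (mem_cubes a))/allP/(_ b (mem_cubes b)).
by move=> /allP/(_ c (mem_cubes c))/allP/(_ d (mem_cubes d)); case: (D _).
Qed.

Definition lone (x : state) (t i : nat) : bool :=
  all (fun s => (s == t) || (coord (get x s) i != coord (get x t) i)) (iota 0 4).

Definition update (x : state) (t : nat) (v : cube) : state :=
  mkstate (fun s => if s == t then v else get x s).

(** A 2-face of the 3-cube fixes one coordinate, so [p] pairs a token with a coordinate in which it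
    differs from all other tokens; the token may go anywhere on that face. *)
Definition moves (x : state) : seq state :=
  flatten [seq [seq update x p.1 v | v <- cubes &
                 (v != get x p.1) && (coord v p.2 == coord (get x p.1) p.2)]
          | p <- [seq (t, i) | t <- iota 0 4, i <- iota 0 3] & lone x p.1 p.2].

Definition key (x : state) : seq bool :=
  flatten [seq [seq coord (get x t) i | i <- iota 0 3] | t <- iota 0 4].

Lemma key_inj : injective key.
Proof.
move=> [[[[[a b] c] [[d e] f]] [[g h] i]] [[j k] l]].
by move=> [[[[[a' b'] c'] [[d' e'] f']] [[g' h'] i']] [[j' k'] l']] [] *; subst.
Qed.

Arguments coord : simpl never.
Arguments get : simpl never.
Arguments inside : simpl never.
Arguments moves : simpl never.

(** * Faces and moves of the 3-cube in coordinates *)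

Lemma pos_inj d l (C : config d l) : injective (pos C).
Proof. exact: (injectiveP _ (valP C)). Qed.

Lemma kface2P (sigma : {set vertex 3}) :
  reflect (exists i b, sigma = [set v : vertex 3 | v i == b]) (is_kface 2 sigma).
Proof.
have face1 i (a : vertex 3) :
    [set v : vertex 3 | [forall j in [set i], v j == a j]] =
    [set v : vertex 3 | v i == a i].
  apply/setP => v; rewrite !inE; apply/forall_inP/idP => [->//|/eqP e j].
    by rewrite inE.
  by rewrite inE => /eqP->; rewrite e.
apply: (iffP existsP) => [[F /existsP[a /andP[/cards1P[i ->] /eqP->]]]|[i [b ->]]].
  by exists i, (a i); exact: face1.
exists [set i]; apply/existsP; exists [ffun=> b].
by rewrite cards1 face1 ffunE !eqxx.
Qed.

(** The face through the token that fixes coordinate [i] is otherwise empty exactly when every other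
    token has the opposite value in that coordinate. *)
Lemma kmove2P l (t : label 3 l) (C D : config 3 l) :
  reflect (exists i, [/\ forall s, s != t -> pos C s i != pos C t i,
                         pos D t i = pos C t i, pos D t != pos C t
                       & forall s, s != t -> pos D s = pos C s])
    (kmove_of 2 t C D).
Proof.
apply: (iffP existsP) => [[sg /and5P[/kface2P[i [b ->]]]]|[i [far Dti nDt same]]].
  rewrite !inE => /eqP <- /forall_inP free /andP[nDt /eqP Dti] /forallP same.
  exists i; split=> // s nst; last exact/eqP/(implyP (same s)).
  apply: contraTneq isT => e.
  have /free/forallP/(_ s) :
      pos C s \in [set v : vertex 3 | v i == pos C t i] :\ pos C t.
    by rewrite !inE e eqxx andbT (inj_eq (@pos_inj _ _ C)).
  by rewrite eqxx.
exists [set v : vertex 3 | v i == pos C t i]; apply/and5P; split.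
- by apply/kface2P; exists i, (pos C t i).
- by rewrite inE.
- apply/forall_inP => v; rewrite !inE => /andP[nv /eqP vi]; apply/forallP => s.
  case: (eqVneq s t) => [->|/far]; first by rewrite eq_sym.
  by apply: contra_neq => ->.
- by rewrite !inE nDt Dti /=.
- by apply/forallP => s; apply/implyP => /same->.
Qed.

Lemma config_eq d l (C D : config d l) : (forall t, pos C t = pos D t) -> C = D.
Proof. by move=> e; apply/val_inj/ffunP. Qed.

Lemma config_of d l (f : label d l -> vertex d) :
  injective f -> exists C : config d l, forall t, pos C t = f t.
Proof.
move=> f_inj.
have H : injectiveb [ffun t => f t].
  by apply/injectiveP => s t; rewrite !ffunE; apply: f_inj.
pose inj (h : {ffun label d l -> vertex d}) : Prop := injectiveb h.
by exists (exist inj _ H) => t; rewrite /pos /= ffunE.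
Qed.

Lemma permuted_ex d l (g : {perm label d l}) (C : config d l) :
  exists D, permuted g C D.
Proof.
have [|D DE] := @config_of d l (fun t => pos C (g t)).
  by move=> s t /pos_inj/perm_inj.
by exists D; apply/forallP => t; rewrite DE.
Qed.

(** * Correspondence between configurations and states *)

Definition code (v : vertex 3) : cube := mkcube (fun i => v (inord i)).
Definition token (t : nat) : label 3 4 := @inord 3 t.
Definition enc (C : config 3 4) : state := mkstate (fun t => code (pos C (token t))).

Lemma coord_code v (i : 'I_3) : coord (code v) i = v i.
Proof. by rewrite coord_mk // inord_val. Qed.

Lemma code_inj : injective code.
Proof. by move=> u v e; apply/ffunP => i; rewrite -!coord_code e. Qed.

Lemma code_surj c : exists v, code v = c.
Proof.
exists [ffun i : 'I_3 => coord c i]; rewrite /code /mkcube !ffunE !inordK //.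
by case: c => [[]].
Qed.

Lemma tokenK (t : label 3 4) : token t = t.
Proof. exact: (@inord_val 3). Qed.

Lemma get_enc C (t : label 3 4) : get (enc C) t = code (pos C t).
Proof. by rewrite get_mk ?tokenK // (ltn_ord t). Qed.

Lemma enc_inj : injective enc.
Proof.
by move=> C D e; apply: config_eq => t; apply: code_inj; rewrite -!get_enc e.
Qed.

Lemma eq_encP C x : (forall t : label 3 4, get x t = code (pos C t)) -> x = enc C.
Proof.
move=> e; apply: get_inj => t lt4.
by rewrite (e (Ordinal lt4 : label 3 4)) -get_enc.
Qed.

Lemma enc_surj x : uniq (mkseq (get x) 4) -> exists C, enc C = x.
Proof.
move/mkseq_uniqP => x_inj.
have /fin_all_exists[f fE] : forall t : label 3 4, exists v, code v = get x t.
  by move=> t; exact: code_surj.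
have [|C CE] := @config_of 3 4 f.
  move=> s t e; apply/val_inj/x_inj; rewrite ?inE ?(ltn_ord s) ?(ltn_ord t) //.
  by rewrite -!fE e.
by exists C; apply/esym/eq_encP => t; rewrite CE fE.
Qed.

Lemma uniq_enc C : uniq (mkseq (get (enc C)) 4).
Proof.
apply/mkseq_uniqP => s t; rewrite !inE => ls lt.
have := get_enc C (Ordinal ls); have := get_enc C (Ordinal lt) => /= -> -> .
by move/code_inj/pos_inj => [].
Qed.

Lemma loneP C (t : label 3 4) (i : 'I_3) :
  reflect (forall s, s != t -> pos C s i != pos C t i) (lone (enc C) t i).
Proof.
apply: (iffP allP) => [H s nst|H s].
  have := H s; rewrite mem_iota (ltn_ord s) (negPf nst : (s == t :> nat) = false).
  by rewrite !get_enc !coord_code; apply.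
rewrite mem_iota => /= ls; pose s' : label 3 4 := Ordinal ls.
have := H s'; rewrite -(inj_eq val_inj) (get_enc C s' : get _ s = _) get_enc.
rewrite !coord_code.
by case: eqP => //= _; apply.
Qed.

(** Together with [enc_inj] and [enc_surj] this makes [enc] an isomorphism from the puzzle graph
    onto the graph of [moves] on states with distinct vertices. *)
Lemma movesP C y :
  reflect (exists2 D, puz 3 2 4 C D & y = enc D) (y \in moves (enc C)).
Proof.
rewrite /moves; apply: (iffP flatten_mapP) =>
    [[[t i]]|[D /existsP[t /kmove2P[i [far Dti nDt same]]] ->]].
  rewrite mem_filter => /andP[+ /allpairsP[[t' i'] [+ + [et ei]]]].
  rewrite -{}et -{}ei {t' i'} !mem_iota => + lt li /mapP[v].
  pose t' : label 3 4 := Ordinal lt; pose i' : 'I_3 := Ordinal li.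
  rewrite -[lone _ _ _]/(lone (enc C) t' i') => /loneP far.
  rewrite mem_filter -[get _ t]/(get (enc C) t') get_enc -andbA.
  case/and3P=> nv /eqP vi _ ->.
  rewrite -[coord (code _) i]/(coord _ i') coord_code in vi.
  have [w wE] := code_surj v; rewrite -wE in nv vi *.
  rewrite (inj_eq code_inj) -[coord _ i]/(coord _ i') coord_code in nv vi.
  have [|D DE] := @config_of 3 4 (fun s => if s == t' then w else pos C s).
    (* The target [w] agrees with the old position of [t'] in coordinate [i'], where all other
       tokens differ, so [w] is free. *)
    have clash s : s != t' -> w <> pos C s.
      by move=> /far; rewrite -vi => + e; rewrite e eqxx.
    move=> r s; case: (eqVneq r t') => [->|nr]; case: (eqVneq s t') => [->|ns] //.
    - by move/(clash _ ns).
    - by move/esym/(clash _ nr).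
    - exact: pos_inj.
  exists D; last first.
    apply: eq_encP => s; rewrite get_mk ?(ltn_ord s) // DE get_enc -(inj_eq val_inj).
    by case: ifP.
  apply/existsP; exists t'; apply/kmove2P; exists i'; rewrite DE eqxx; split=> //.
  by move=> s /negPf ns; rewrite DE ns.
exists (val t, val i).
  rewrite mem_filter; apply/andP; split; first exact/loneP.
  by apply/allpairsP; exists (val t, val i); rewrite !mem_iota /= (ltn_ord t) ltn_ord.
apply/mapP; exists (code (pos D t)); last first.
  apply/esym/eq_encP => s; rewrite get_mk ?(ltn_ord s) // get_enc (inj_eq val_inj).
  by case: eqVneq => [->//|/same->].
by rewrite mem_filter mem_cubes !get_enc (inj_eq code_inj) nDt !coord_code Dti eqxx.
Qed.

(** * The two classes of non-isolated configurations *)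

(** A counterpart of [tperm] on natural numbers that evaluates quickly. *)
Definition transpose (a b t : nat) : nat :=
  if t == a then b else if t == b then a else t.

Definition swap (a b : nat) (x : state) : state :=
  mkstate (fun t => get x (transpose a b t)).

Definition turn (f : cube -> cube) (x : state) : state :=
  mkstate (fun t => f (get x t)).

(** Adjacent transpositions of labels, one reflection and adjacent transpositions of coordinates:
    involutions generating all relabellings and all symmetries of the cube. *)
Definition generators : seq (state -> state) :=
  [:: swap 0 1; swap 1 2; swap 2 3;
      turn (fun v => mkcube (fun i => (i == 0) (+) coord v i));
      turn (fun v => mkcube (fun i => coord v (transpose 0 1 i)));
      turn (fun v => mkcube (fun i => coord v (transpose 1 2 i)))].

Definition orbit_step (x : state) : seq state := [seq s x | s <- generators].

Definition closed_under (P : pred state) := forall x y, P x -> y \in moves x -> P y.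

Definition good (x : state) := forall n y, walk moves n x y -> walk moves 10 x y.

(** A closed set containing [r] contains everything reachable from [r], so a closed ball of radius
    10 bounds all distances from its centre. *)
Lemma good_rep (P : pred state) r :
  closed_under P -> P r -> (forall x, P x -> walk moves 10 r x) -> good r.
Proof. by move=> Pc Pr Pw n y /(walk_closed Pc)/(_ Pr)/Pw. Qed.

Definition symmetries_of (P : pred state) := forall x i,
  P x -> i < size generators ->
  let s := nth id generators i in
  [/\ P (s x), s (s x) = x & forall y, y \in moves x -> s y \in moves (s x)].

(** The involution carries a walk from [s x] to one from [x]; this is replaced by a walk of length
    at most 10, which is carried back. *)
Lemma good_generator (P : pred state) x i :
  closed_under P -> symmetries_of P ->
  P x -> i < size generators -> good x -> good (nth id generators i x).
Proof.
move=> Pc Ps Px ilt gx n y sxy; have [] := Ps _ _ Px ilt.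
set s := nth id generators i in sxy * => Psx ssx _.
have mor a b : P a -> b \in moves a -> s b \in moves (s a).
  by move=> Pa; have [_ _] := Ps _ _ Pa ilt; apply.
have Py : P y := walk_closed Pc sxy Psx.
have := walk_map Pc mor Psx sxy; rewrite ssx => /gx.
move/(walk_map Pc mor Px).
by have := Ps _ _ Py ilt; rewrite -/s => -[_ -> _].
Qed.

Lemma good_orbit (P : pred state) r x n :
  closed_under P -> symmetries_of P ->
  P r -> good r -> walk orbit_step n r x -> good x.
Proof.
move=> Pc Ps Pr gr [p [+ <- _]] {x}; elim: p r Pr gr => //= a p IH r Pr gr /andP[].
case/(nthP r) => i; rewrite size_map => ilt; rewrite (nth_map id) // => <-.
by apply: IH; [case: (Ps _ _ Pr ilt) | exact: good_generator Ps Pr ilt gr].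
Qed.

(** * Representatives and exhaustive checks *)

Definition vertex_of (n : nat) : cube := mkcube (fun i => odd (n %/ 2 ^ i)).
Definition state_of (a b c d : nat) : state :=
  (vertex_of a, vertex_of b, vertex_of c, vertex_of d).

(** In a non-isolated state three tokens fill a face but for one vertex, and the fourth lies on the
    opposite face. It sits across from the middle one of the three ([rep1]), an end one ([rep2]) or
    the gap ([rep3]). The labels of [rep2] are chosen to put it in the other class than [rep1],
    while [rep3] is one move away from [rep1]. *)
Definition rep1 := state_of 0 1 2 4.
Definition rep2 := state_of 0 1 5 2.
Definition rep3 := state_of 0 1 2 7.

Definition ball1 := ball key moves 10 rep1.
Definition ball2 := ball key moves 10 rep2.
Definition ball3 := ball key moves 10 rep3.

(* Locked, lest unification run the searches. *)
Definition in1 : pred state := locked (inside key ball1).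
Definition in2 : pred state := locked (inside key ball2).
Definition in3 : pred state := locked (inside key ball3).
Definition in12 (x : state) : bool := in1 x || in2 x.

Lemma in1E : in1 = inside key ball1.
Proof. by rewrite /in1 -lock. Qed.

Lemma in2E : in2 = inside key ball2.
Proof. by rewrite /in2 -lock. Qed.

Lemma in3E : in3 = inside key ball3.
Proof. by rewrite /in3 -lock. Qed.

Lemma in1_walk x : in1 x -> walk moves 10 rep1 x.
Proof. by rewrite in1E /ball1 => /(ball_walk key_inj). Qed.

Lemma in2_walk x : in2 x -> walk moves 10 rep2 x.
Proof. by rewrite in2E /ball2 => /(ball_walk key_inj). Qed.

Lemma in3_walk x : in3 x -> walk moves 10 rep3 x.
Proof. by rewrite in3E /ball3 => /(ball_walk key_inj). Qed.

Lemma in_closed : [/\ closed_under in1, closed_under in2 & closed_under in3].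
Proof.
pose closed P := all_states P (fun x => all P (moves x)).
have closedP P : closed P -> closed_under P.
  by move=> /all_statesP H x y /H Px; apply/allP.
have /and3P[c1 c2 c3] : [&& closed in1, closed in2 & closed in3].
  (* The cast postpones the evaluation to [Qed], where the virtual machine performs it. *)
  by rewrite in1E in2E in3E; vm_cast_no_check (erefl true).
by split; apply: closedP.
Qed.

Lemma in12_cover x : uniq (mkseq (get x) 4) -> moves x != [::] -> in12 x.
Proof.
have /all_statesP/(_ x) : all_states
    (fun x => uniq (mkseq (get x) 4) && (moves x != [::])) in12.
  by rewrite /in12 in1E in2E; vm_cast_no_check (erefl true).
by move=> /[swap] -> /[swap] ->; apply.
Qed.

Lemma in_swap x a b : a < 4 -> b < 4 -> a != b ->
  (in1 x -> in2 (swap a b x)) /\ (in2 x -> in1 (swap a b x)).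
Proof.
pose swaps (P Q : pred state) := all_states P (fun x =>
  all (fun a => all (fun b => (a == b) || Q (swap a b x)) (iota 0 4)) (iota 0 4)).
have swapsP P Q : swaps P Q ->
    P x -> a \in iota 0 4 -> b \in iota 0 4 -> a != b -> Q (swap a b x).
  move=> /all_statesP/(_ x) H /H/allP{}H /H/allP{}H /H.
  by case: (a == b).
have /andP[s12 s21] : swaps in1 in2 && swaps in2 in1.
  by rewrite in1E in2E; vm_cast_no_check (erefl true).
rewrite !mem_iota in swapsP * => la lb nab.
by split=> xP; [exact: swapsP s12 xP la lb nab | exact: swapsP s21 xP la lb nab].
Qed.

Lemma in12_symmetries : symmetries_of in12.
Proof.
move=> x i.
have /all_statesP/(_ x) H : all_states in12 (fun x =>
    all (fun s : state -> state => [&& in12 (s x), s (s x) == x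
      & all (mem (moves (s x))) (map s (moves x))]) generators).
  by rewrite /in12 in1E in2E; vm_cast_no_check (erefl true).
move=> /H /(all_nthP id) {}H /H /and3P[h1 /eqP h2 /allP h3].
by apply: And3 h1 h2 _ => y /(map_f _)/h3.
Qed.

(** Depth 14 is enough for the three orbits to cover both classes, as [orbit_cover] checks. *)
Definition orbit1 := ball key orbit_step 14 rep1.
Definition orbit2 := ball key orbit_step 14 rep2.
Definition orbit3 := ball key orbit_step 14 rep3.

Lemma orbit_cover x : in12 x ->
  [\/ walk orbit_step 14 rep1 x, walk orbit_step 14 rep2 x
     | walk orbit_step 14 rep3 x].
Proof.
have /all_statesP/(_ x) H : all_states in12 (fun x =>
    [|| inside key orbit1 x, inside key orbit2 x | inside key orbit3 x]).
  by rewrite /in12 in1E in2E; vm_cast_no_check (erefl true).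
case/H/or3P; rewrite ?/orbit1 ?/orbit2 ?/orbit3 => /(ball_walk key_inj) rx.
- exact: Or31.
- exact: Or32.
- exact: Or33.
Qed.

Lemma in_reps : [&& in1 rep1, in2 rep2, ~~ in1 rep2, in3 rep3 & in12 rep3].
Proof. by rewrite /in12 in1E in2E in3E; vm_cast_no_check (erefl true). Qed.

Lemma good_in12 x : in12 x -> good x.
Proof.
have [c1 c2 c3] := in_closed; have /and5P[r1 r2 _ r3 r3'] := in_reps.
have c12 : closed_under in12.
  move=> {}x y /orP[xP|xP] yx; apply/orP.
    by left; exact: c1 xP yx.
  by right; exact: c2 xP yx.
have r1' : in12 rep1 by apply/orP; left; exact: r1.
have r2' : in12 rep2 by apply/orP; right; exact: r2.
case/orbit_cover => rx.
- exact: good_orbit c12 in12_symmetries r1' (good_rep c1 r1 in1_walk) rx.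
- exact: good_orbit c12 in12_symmetries r2' (good_rep c2 r2 in2_walk) rx.
- exact: good_orbit c12 in12_symmetries r3' (good_rep c3 r3 in3_walk) rx.
Qed.

Definition rep (b : bool) : state := if b then rep2 else rep1.

(* Forgetting how the classes are computed keeps them from being unfolded later. *)
Record two_classes := TwoClasses {
  class_of : bool -> pred state;
  class_closed : forall b, closed_under (class_of b);
  class_rep : forall b, class_of b (rep b);
  class_disjoint : ~~ class_of false (rep true);
  class_walk : forall b x, class_of b x -> walk moves 10 (rep b) x;
  class_good : forall b x, class_of b x -> good x;
  class_cover : forall x,
    uniq (mkseq (get x) 4) -> moves x != [::] -> exists b, class_of b x;
  class_swap : forall b x i j, i < 4 -> j < 4 -> i != j ->
    class_of b x -> class_of (~~ b) (swap i j x)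
}.

Lemma classification : two_classes.
Proof.
have [c1 c2 _] := in_closed; have /and5P[r1 r2 r12 _ _] := in_reps.
exists (fun b => if b then in2 else in1).
- by case; [exact: c2 | exact: c1].
- by case; [exact: r2 | exact: r1].
- exact: r12.
- by case; [exact: in2_walk | exact: in1_walk].
- case=> x xP; apply: good_in12; apply/orP.
    by right; exact: xP.
  by left; exact: xP.
- move=> x xu xm; case/orP: (in12_cover xu xm) => xP.
    by exists false; exact: xP.
  by exists true; exact: xP.
- move=> b x i j li lj nij; have [s1 s2] := in_swap x li lj nij.
  by case: b; [exact: s2 | exact: s1].
Qed.

(** * Four tokens *)

Lemma path_enc C p : path (puz 3 2 4) C p ->
  path (fun x y => y \in moves x) (enc C) (map enc p).
Proof.
elim: p C => //= D p IH C /andP[CD /IH ->]; rewrite andbT.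
by apply/movesP; exists D.
Qed.

Lemma connect_walk C D :
  connect (puz 3 2 4) C D -> exists n, walk moves n (enc C) (enc D).
Proof.
case/connectP=> p /path_enc pp ->; exists (size p), (map enc p).
by rewrite pp last_map size_map.
Qed.

Lemma walk_within n C D :
  walk moves n (enc C) (enc D) -> solvable_within 2 n C D.
Proof.
case=> q [qp lq sq].
have [p [pp pq]] : exists p, path (puz 3 2 4) C p /\ map enc p = q.
  elim: q C qp {lq sq} => [|x q IH] C /=; first by exists [::].
  case/andP=> /movesP[E CE ->] /IH[p [pp <-]].
  by exists (E :: p); rewrite /= CE.
exists p; split=> //; last by rewrite -pq size_map in sq.
by apply: enc_inj; rewrite -lq -pq last_map.
Qed.

Lemma within_connect n (C D : config 3 4) :
  solvable_within 2 n C D -> connect (puz 3 2 4) C D.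
Proof. by case=> p [pp <- _]; apply/connectP; exists p. Qed.

Local Notation in_class := (class_of classification).

(** Each class is closed under moves, and its members are all joined to its representative; symmetry
    of the puzzle graph then joins any two of them. *)
Lemma in_class_connect b C D :
  in_class b (enc C) -> connect (puz 3 2 4) C D = in_class b (enc D).
Proof.
have from_rep E : in_class b (enc E) -> walk moves 10 (rep b) (enc E).
  exact: class_walk.
have [R RE] : exists R, enc R = rep b.
  by apply: enc_surj; case: b {from_rep}.
rewrite -RE in from_rep => bC; apply/idP/idP => [/connect_walk[n CD]|bD].
  exact: walk_closed (@class_closed classification b) CD bC.
apply: (@connect_trans _ _ R); last exact/within_connect/walk_within/from_rep.
rewrite (sym_connect_sym (@puz_sym 3 2 4)).
exact/within_connect/walk_within/from_rep.
Qed.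

Lemma isolatedE (C : config 3 4) : isolated 2 C = (moves (enc C) == [::]).
Proof.
apply/forallP/eqP => [iso|e D]; last first.
  by apply/negP => CD; have : enc D \in moves (enc C);
    [apply/movesP; exists D | rewrite e].
case E: (moves (enc C)) => [//|y s].
have /movesP[D CD _] : y \in moves (enc C) by rewrite E mem_head.
by have := iso D; rewrite CD.
Qed.

Lemma not_isolated_class (C : config 3 4) :
  ~~ isolated 2 C -> exists b, in_class b (enc C).
Proof.
by rewrite isolatedE; apply: class_cover; exact: uniq_enc.
Qed.

Lemma enc_tperm (C D : config 3 4) (a b : label 3 4) :
  permuted (tperm a b) C D -> enc D = swap a b (enc C).
Proof.
move=> /forallP DE; apply/esym/eq_encP => t.
rewrite get_mk ?(ltn_ord t) // (eqP (DE t)) -get_enc /transpose; congr (get _ _).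
case: tpermP => [->|->|/eqP + /eqP]; rewrite ?eqxx //.
- by case: eqP => [->|].
- by rewrite -!(inj_eq val_inj) => /negPf-> /negPf->.
Qed.

(** Each transposition in a factorization of [g] exchanges the classes, so the class changes by the
    sign of [g]. *)
Lemma permuted_class b (C D : config 3 4) (g : {perm label 3 4}) :
  permuted g C D -> in_class b (enc C) -> in_class (b (+) odd_perm g) (enc D).
Proof.
have [ts -> dts] := prod_tpermP g.
elim: ts b dts D => [|[s t] ts IH] b /=.
  move=> _ D; rewrite big_nil odd_perm1 addbF => /forallP DE.
  by have -> // : D = C; apply: config_eq => u; rewrite (eqP (DE u)) perm1.
case/andP=> nst dts D; rewrite big_cons odd_permM odd_tperm nst /=.
set g' := (\prod_(_ <- _) _)%g; move=> /forallP DE bC.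
(* Products of permutations apply their left factor first, so [D] arises by permuting with [g'] and
   then exchanging [s] and [t]. *)
have [E CE] := permuted_ex g' C; have := IH b dts E CE bC.
have -> : enc D = swap s t (enc E).
  apply: enc_tperm; apply/forallP => u; rewrite (eqP (DE u)) permM.
  by have /forallP/(_ (tperm s t u))/eqP-> := CE.
by rewrite addbN; apply: class_swap; rewrite ?(ltn_ord s) ?(ltn_ord t).
Qed.

Lemma even_connect (C D : config 3 4) (g : {perm label 3 4}) :
  ~~ isolated 2 C -> permuted g C D -> ~~ odd_perm g -> connect (puz 3 2 4) C D.
Proof.
case/not_isolated_class=> b bC CD /negPf even.
by rewrite (in_class_connect _ bC) -(addbF b) -even; apply: permuted_class CD bC.
Qed.

(** Supplies an even permutation that displaces a prescribed label. *)
Lemma cycle3_even (T : finType) (x y z : T) (g := (tperm x y * tperm y z)%g) :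
  [/\ x != y, y != z & z != x] -> ~~ odd_perm g /\ g x = z.
Proof.
by case=> xy yz zx; rewrite odd_permM !odd_tperm xy yz permM tpermL tpermL.
Qed.

Lemma kmove_in_fixed d k l (A : {set label d l}) (C D : config d l) a :
  a \in A -> connect (kmove_in k (~: A)) C D -> pos D a = pos C a.
Proof.
move=> aA /connectP[p + ->] {D}; elim: p C => //= D p IH C /andP[+ /IH->].
case/existsP=> t /andP[tA /existsP[sg /and5P[_ _ _ _ /forallP/(_ a)/implyP same]]].
by apply/eqP/same; apply: contraTneq tA => <-; rewrite inE aA.
Qed.

(** In a semi-isolated configuration some label [a] would keep its place throughout the component;
    but a 3-cycle through [a] is even, so its result lies in the component, with [a] displaced. *)
Lemma mobileE (C : config 3 4) : mobile 2 C = ~~ isolated 2 C.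
Proof.
rewrite /mobile; case: (boolP (isolated 2 C)) => //= nisoC.
apply/negP => /existsP[A /and3P[/set0Pn[a aA] _ /forall_inP compA]].
have /card_gt1P[y [z [ya za yz]]] : 1 < #|~: [set a]|.
  by rewrite cardsCs setCK cards1 card_ord.
rewrite !inE in ya za.
have [|even ga] := @cycle3_even _ a y z; first by rewrite eq_sym.
have [D CD] := permuted_ex (tperm a y * tperm y z)%g C.
have := even_connect nisoC CD even.
have /forallP/(_ a)/eqP := CD; rewrite ga => Da cCD.
have := kmove_in_fixed aA (compA D _); rewrite inE Da => /(_ cCD)/pos_inj e.
by rewrite e eqxx in za.
Qed.

Lemma strong_parity_3_2_4 : strong_parity 3 2 4.
Proof.
have [C1 C1E] : exists C, enc C = rep false by exact: enc_surj.
have [C2 C2E] : exists C, enc C = rep true by exact: enc_surj.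
have c1 D : (D \in component 2 C1) = in_class false (enc D).
  by rewrite inE (@in_class_connect false) // C1E; exact: class_rep.
have c2 D : (D \in component 2 C2) = in_class true (enc D).
  by rewrite inE (@in_class_connect true) // C2E; exact: class_rep.
rewrite /strong_parity.
have -> : [set component 2 C | C : config 3 4 & mobile 2 C] =
    [set component 2 C1; component 2 C2].
  apply/setP => K; rewrite !inE; apply/imsetP/orP => [[C]|].
    rewrite inE mobileE => /not_isolated_class[b bC] ->.
    by case: b bC => bC; [right | left]; apply/eqP/setP => D;
      rewrite ?c1 ?c2 inE; exact: in_class_connect.
  by case=> /eqP->; [exists C1 | exists C2] => //; rewrite inE mobileE isolatedE
    ?C1E ?C2E.
(* Equal components would put the representative of one class into the other. *)
rewrite cards2; suff -> : component 2 C1 != component 2 C2 by [].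
apply: contraNneq (class_disjoint classification) => e.
by rewrite -C2E -c1 e c2 C2E; exact: class_rep.
Qed.

Lemma even_solvability_3_2_4 : even_solvability 3 2 4.
Proof.
have [C CE] : exists C, enc C = rep false by exact: enc_surj.
apply/existsP; exists C; apply/forallP => g; apply/implyP => even.
apply/forallP => D; apply/implyP => CD; rewrite inE.
by apply: even_connect CD even; rewrite isolatedE CE.
Qed.

Lemma solvable_within_10 (C D : config 3 4) :
  solvable_puzzle 2 C D -> solvable_within 2 10 C D.
Proof.
move=> CD; have [iso|/not_isolated_class[b bC]] := boolP (isolated 2 C).
  case/connectP: CD => -[|E p] /=; first by move=> _ ->; exists [::].
  by case/andP=> CE; have /forallP/(_ E) := iso; rewrite CE.
have [n CDn] := connect_walk CD.
exact/walk_within/(class_good bC CDn).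
Qed.

(** * Five or more tokens *)

Definition lone_token l (C : config 3 l) (t : label 3 l) : bool :=
  [exists i, forall (s | s != t), pos C s i != pos C t i].

Lemma kmove_lone l (t : label 3 l) (C D : config 3 l) :
  kmove_of 2 t C D -> lone_token C t && lone_token D t.
Proof.
case/kmove2P=> i [far Dti _ same].
apply/andP; split; apply/existsP; exists i; apply/forall_inP => s nst.
  exact: far.
by rewrite Dti same // far.
Qed.

(** If [s] and [t] are separated by the same coordinate, a third token differs from both there, so
    they agree, a contradiction. If the coordinates are distinct, all other tokens agree in both and
    hence lie on an edge, which has room for only two. *)
Lemma lone_token_unique l (C : config 3 l) s t :
  l < 4 -> lone_token C s -> lone_token C t -> s = t.
Proof.
move=> l4 /existsP[i /forall_inP fars] /existsP[j /forall_inP fart].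
apply: contraTeq isT => nst.
have notE (a b : bool) : a != b -> a = ~~ b by case: a b => -[].
(* At least five tokens leave at least three besides [s] and [t]. *)
have cardA : 2 < #|~: [set s; t]|.
  rewrite cardsCs setCK cards2 nst card_ord.
  by case: l l4 {C s t fars fart nst} => [|[|[|[|]]]].
have others u : u \in ~: [set s; t] ->
    pos C u i = ~~ pos C s i /\ pos C u j = ~~ pos C t j.
  rewrite !inE negb_or => /andP[us ut].
  by split; apply: notE; [exact: fars | exact: fart].
have [eij|nij] := eqVneq i j.
  have /card_gt0P[u /others[]] : 0 < #|~: [set s; t]| by apply: leq_trans cardA.
  by rewrite -eij => -> /negb_inj e; have := fart _ nst; rewrite -eij e eqxx.
have /cards1P[k kE] : #|~: [set i; j]| == 1.
  by rewrite cardsCs setCK cards2 nij card_ord.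
(* Only the third coordinate [k] can tell the other tokens apart, and it takes two values. *)
suff /leq_card_in : {in ~: [set s; t] &, injective (fun u => pos C u k)}.
  by rewrite card_bool leqNgt cardA.
move=> u v /others[ui uj] /others[vi vj] uvk; apply/(@pos_inj _ _ C)/ffunP => m.
have [->|mi] := eqVneq m i; first by rewrite ui vi.
have [->|mj] := eqVneq m j; first by rewrite uj vj.
have : m \in ~: [set i; j] by rewrite !inE negb_or mi.
by rewrite kE inE => /eqP->.
Qed.

(** A moving token is lone before and after its move, so by uniqueness it is the only one that can
    move next. If no token is lone, nothing moves and any label serves as [t]. *)
Lemma one_moving_token l (C : config 3 l) :
  l < 4 ->
  exists t, forall D s, connect (puz 3 2 l) C D -> s != t -> pos D s = pos C s.
Proof.
move=> l4; case: (pickP (lone_token C)) => [t tC|none].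
  exists t => D s /connectP[p + ->] nst.
  elim: p C tC => //= E p IH C tC /andP[+ /IH{}IH].
  case/existsP=> t' CE; have /andP[t'C t'E] := kmove_lone CE.
  have et := lone_token_unique l4 t'C tC; rewrite et in CE t'E.
  by rewrite IH //; case/kmove2P: CE => i [_ _ _]; apply.
have t : label 3 l by case: l l4 C none => [|[|[|[|]]]] //= _ _ _; exact: ord0.
exists t => D s /connectP[[_ ->//|E p /= /andP[/existsP[u CE] _]]].
by have := kmove_lone CE; rewrite none.
Qed.

(** A 3-cycle on labels other than the one that may move is even, yet displaces tokens that are
    fixed throughout the component. *)
Lemma not_even_solvability l : l < 4 -> ~~ even_solvability 3 2 l.
Proof.
move=> l4; apply/negP => /existsP[C /forallP solv].
have [t fixed] := one_moving_token C l4.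
have /card_gt2P[x [y [z [[xt yt zt] xyz]]]] : 2 < #|~: [set t]|.
  rewrite cardsCs setCK cards1 card_ord.
  by case: l l4 {C solv t fixed} => [|[|[|[|]]]].
have [even gx] := cycle3_even xyz; have [_ _ zx] := xyz.
have [D CD] := permuted_ex (tperm x y * tperm y z)%g C.
have /implyP/(_ even)/forallP/(_ D)/implyP/(_ CD) := solv (tperm x y * tperm y z)%g.
rewrite !inE in xt * => /fixed/(_ xt) DC.
have /forallP/(_ x)/eqP := CD; rewrite gx DC => /pos_inj e.
by rewrite e eqxx in zx.
Qed.

(** * The value of [S_min] and the conclusion *)

Lemma S_min_3_2 : S_min 3 2 = 4.
Proof.
rewrite /S_min; case: ex_minnP => m /and3P[_ _ ev] min.
apply/eqP; rewrite eqn_leq min ?even_solvability_3_2_4 //= leqNgt.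
by apply: contraL ev => /not_even_solvability.
Qed.

Theorem theorem1p16 :
  [/\ S_min 3 2 = 4,
      forall C D : config 3 4,
        solvable_puzzle 2 C D -> solvable_within 2 10 C D
    & strong_parity 3 2 (S_min 3 2)].
Proof.
rewrite S_min_3_2; split=> //; first exact: solvable_within_10.
exact: strong_parity_3_2_4.
Qed.
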